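(* Let $(G_n)_{n\ge 1}$ be a sequence of (possibly random, almost surely finite) graphs, let $o_n$ be a uniformly chosen vertex of $G_n$, and assume that $(d_{o_n}^2)_{n\ge 1}$ is uniformly integrable. Let $(G,o)$ be a random connected locally finite rooted graph with law $\mu$ such that $\mu(d_o\ge 1)>0$, and assume that $G_n$ converges locally in probability to $(G,o)$. Then for every integer $k\ge 1$ such that $\mu(d_o=k)>0$, $$\Phi_{G_n}(k)\ \xrightarrow{\ \mathbb{P}\ }\ \mathbb{E}_\mu[d_V\mid d_o=k]\qquad (n\to\infty),$$ where $V$ is a neighbour of $o$ in $G$ chosen uniformly at random.
   Context: Graphs are simple and undirected; $d_v$ denotes the degree of vertex $v$. For a graph $G$, $\vec{E}(G)$ is the set of ordered pairs $(u,v)$ with $\{u,v\}\in E(G)$ (each undirected edge gives two directed edges), and $\sum_{u\to v}$ denotes summation over $(u,v)\in\vec{E}(G)$. Local convergence in probability: for a locally finite rooted graph $(G,o)$ and integer $r\ge 0$, $B_r^{(G)}(o)$ is the subgraph of $G$ induced by the vertices at graph distance at most $r$ from $o$, rooted at $o$; $\simeq$ denotes isomorphism of rooted graphs (a graph isomorphism mapping root to root). The sequence $G_n$ converges locally in probability to the random connected rooted graph $(G,o)$ with law $\mu$ if for every rooted graph $H_\star$ and every integer $r\ge 0$, $\frac{1}{|V(G_n)|}\sum_{v\in V(G_n)}\mathbf{1}_{\{B_r^{(G_n)}(v)\simeq H_\star\}}\to\mu(B_r^{(G)}(o)\simeq H_\star)$ in probability as $n\to\infty$. $\mathbb{E}_\mu$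 is expectation over $(G,o)\sim\mu$ and over the uniform choice of the neighbour $V$. Uniform integrability is with respect to the joint randomness of $G_n$ and $o_n$. Average nearest neighbour degree (ANND) of a finite graph $G$: let $f_G(k)=\frac{1}{|V(G)|}\sum_{v\in V(G)}\mathbf{1}_{\{d_v=k\}}$, $f^*_G(k)=\frac{1}{|\vec{E}(G)|}\sum_{u\to v}\mathbf{1}_{\{d_u=k\}}$ and $h_G(k,\ell)=\frac{1}{|\vec{E}(G)|}\sum_{u\to v}\mathbf{1}_{\{d_u=k,\,d_v=\ell\}}$. For $k=1,2,\dots$, $$\Phi_G(k)=\mathbf{1}_{\{f_G(k)>0\}}\frac{\sum_{\ell>0}\ell\,h_G(k,\ell)}{f^*_G(k)},$$ interpreted as $0$ when $f_G(k)=0$. *)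

(* Defs.v *)
From HB Require Import structures.
From mathcomp Require Import all_boot all_order all_algebra.
From mathcomp Require Import finmap.
From mathcomp Require Import all_classical all_reals all_analysis.

Set Implicit Arguments.
Unset Strict Implicit.
Unset Printing Implicit Defensive.

Import Order.TTheory GRing.Theory Num.Theory.
Import numFieldNormedType.Exports.

Local Open Scope classical_set_scope.
Local Open Scope ring_scope.

(* Vertices are labelled by natural numbers.  This loses no generality up to
   isomorphism: finite graphs and connected locally finite graphs are
   countable. *)
Record sgraph := SGraph {
  vert : set nat;
  adj : rel nat;
  adj_sym : symmetric adj;
  adj_irr : irreflexive adj;
  adj_vert : forall u v, adj u v -> vert u }.

(* The number of elements of a finite set; 0 on infinite sets. *)
Definition ncard (T : choiceType) (A : set T) : nat := #|` fset_set A|%fset.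

Definition nbrs (G : sgraph) (v : nat) : set nat := [set u | adj G v u].

Definition deg (G : sgraph) (v : nat) : nat := ncard (nbrs G v).

Definition locally_finite (G : sgraph) : Prop :=
  forall v, vert G v -> finite_set (nbrs G v).

Definition dist_le (G : sgraph) (r : nat) (u v : nat) : Prop :=
  exists p : seq nat, [/\ path (adj G) u p, last u p = v & (size p <= r)%N].

Definition connected_graph (G : sgraph) : Prop :=
  forall u v, vert G u -> vert G v -> exists r, dist_le G r u v.

Section Induced.
Variables (G : sgraph) (A : set nat).

Let iadj : rel nat := fun u v => [&& adj G u v, u \in A & v \in A].

Fact iadj_sym : symmetric iadj.
Proof. by move=> u v; rewrite /iadj adj_sym [(u \in A) && _]andbC. Qed.

Fact iadj_irr : irreflexive iadj.
Proof. by move=> u; rewrite /iadj adj_irr. Qed.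

Fact iadj_vert u v : iadj u v -> (vert G `&` A) u.
Proof. by case/and3P=> /adj_vert Gu /set_mem Au _; split. Qed.

Definition induced : sgraph := SGraph iadj_sym iadj_irr iadj_vert.

End Induced.

(* The graph underlying B_r(o), which is always rooted at o. *)
Definition ball_graph (G : sgraph) (r : nat) (o : nat) : sgraph :=
  induced G [set v | dist_le G r o v].

Definition rooted_iso (G : sgraph) (o : nat) (H : sgraph) (h : nat) : Prop :=
  exists f : nat -> nat,
    [/\ set_bij (vert G) (vert H) f, f o = h &
        forall u v, vert G u -> vert G v -> adj H (f u) (f v) = adj G u v].

Record clf_rgraph := CLFRGraph {
  ugraph :> sgraph;
  groot : nat;
  groot_vert : vert ugraph groot;
  ugraph_connected : connected_graph ugraph;
  ugraph_locally_finite : locally_finite ugraph }.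

Section OnePoint.
Let adj0 : rel nat := fun _ _ => false.
Let adj0_sym : symmetric adj0. Proof. by []. Qed.
Let adj0_irr : irreflexive adj0. Proof. by []. Qed.
Let adj0_vert u v : adj0 u v -> [set 0%N] u. Proof. by []. Qed.
Definition one_point : sgraph := SGraph adj0_sym adj0_irr adj0_vert.

Let one_point_connected : connected_graph one_point.
Proof. by move=> u v /= -> ->; exists 0%N; exists [::]. Qed.

Let one_point_locally_finite : locally_finite one_point.
Proof.
move=> v _; rewrite (_ : nbrs _ _ = set0); first exact: finite_set0.
by rewrite -subset0.
Qed.

Definition one_point_rgraph : clf_rgraph :=
  @CLFRGraph one_point 0%N erefl one_point_connected one_point_locally_finite.
End OnePoint.

HB.instance Definition _ := gen_eqMixin clf_rgraph.
HB.instance Definition _ := gen_choiceMixin clf_rgraph.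
HB.instance Definition _ := isPointed.Build clf_rgraph one_point_rgraph.

Definition ball_event (r : nat) (H : sgraph) (h : nat) : set clf_rgraph :=
  [set x : clf_rgraph | rooted_iso (ball_graph x r (groot x)) (groot x) H h].

Definition ball_events : set (set clf_rgraph) :=
  [set A | exists r H h, vert H h /\ A = ball_event r H h].

(* The sigma-algebra generated by the ball events is the Borel sigma-algebra of
   the local topology.  Its members are invariant under rooted isomorphism, so
   a probability on this type is the same as a law on isomorphism classes of
   connected locally finite rooted graphs. *)
Definition rgraph_space := g_sigma_algebraType ball_events.

Section ANND.
Variables (R : realType) (G : sgraph).

Definition dir_edges : set (nat * nat) := [set e | adj G e.1 e.2].

Definition deg_pmf (k : nat) : R :=
  (ncard (vert G))%:R^-1 * \sum_(v \in vert G) ((deg G v == k)%:R : R).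

Definition deg_pmf_star (k : nat) : R :=
  (ncard dir_edges)%:R^-1 * \sum_(e \in dir_edges) ((deg G e.1 == k)%:R : R).

Definition deg_joint (k l : nat) : R :=
  (ncard dir_edges)%:R^-1 *
  \sum_(e \in dir_edges) (((deg G e.1 == k) && (deg G e.2 == l))%:R : R).

Definition annd (k : nat) : R :=
  ((0 < deg_pmf k)%R : bool)%:R *
  ((\sum_(l \in [set l | (0 < l)%N]) l%:R * deg_joint k l) / deg_pmf_star k).

Definition ball_freq (r : nat) (H : sgraph) (h : nat) : R :=
  (ncard (vert G))%:R^-1 *
  \sum_(v \in vert G) (`[< rooted_iso (ball_graph G r v) v H h >]%:R : R).

End ANND.

Section RandomGraph.
Context {R : realType} {d : measure_display} {T : measurableType d}.
Variable P : probability T R.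

(* The finite graphs on natural numbers are countably many, so measurability
   amounts to that of the events G = g, up to the null event where G is
   infinite. *)
Definition random_graph (G : T -> sgraph) : Prop :=
  (forall g, finite_set (vert g) -> measurable [set w | G w = g]) /\
  {ae P, forall w, finite_set (vert (G w))}.

(* Given G = g, the vertex o is uniform on the vertices of g.  For the empty g,
   summing over v shows that G = g has probability 0. *)
Definition uniform_vertex (G : T -> sgraph) (o : T -> nat) : Prop :=
  forall g, finite_set (vert g) -> forall v : nat,
    measurable [set w | G w = g /\ o w = v] /\
    P [set w | G w = g /\ o w = v] =
      (P [set w | G w = g] *
       ((v \in vert g)%:R / (ncard (vert g))%:R)%:E)%E.

(* E[X | A] for an event A of positive probability. *)
Definition event_expectation (X : T -> \bar R) (A : set T) : \bar R :=
  ((\int[P]_(w in A) X w) * (fine (P A))^-1%:E)%E.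

End RandomGraph.

Section Sequences.
Context {R : realType} {d : nat -> measure_display}.
Context {T : forall n, measurableType (d n)}.
Variable P : forall n, probability (T n) R.

Definition tail_expectation (X : forall n, T n -> R) (K : R) (n : nat) : \bar R :=
  (\int[P n]_(w in [set w | (K < `|X n w : R|)%R]) (`|X n w : R|%R)%:E)%E.

Definition uniformly_integrable (X : forall n, T n -> R) : Prop :=
  ereal_sup (range (tail_expectation X K)) @[K --> +oo%R] --> 0%E.

Definition cvg_in_probability (X : forall n, T n -> R) (c : R) : Prop :=
  forall e : R, 0 < e ->
    P n [set w | e < `|X n w - c|] @[n --> \oo] --> 0%E.

Definition cvg_locally_in_probability (G : forall n, T n -> sgraph)
    (mu : probability rgraph_space R) : Prop :=
  forall (H : sgraph) (h : nat), vert H h -> forall r : nat,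
    cvg_in_probability (fun n w => ball_freq R (G n w) r H h)
                       (fine (mu (ball_event r H h))).

End Sequences.

(* E[d_V | (G, o)] for V a uniform neighbour of o. *)
Definition nbr_deg_mean (R : realType) (x : rgraph_space) : R :=
  (deg x (groot x))%:R^-1 * \sum_(v \in nbrs x (groot x)) ((deg x v)%:R : R).

Definition root_deg_eq (k : nat) : set rgraph_space :=
  [set x : clf_rgraph | deg x (groot x) = k].

(* E_mu[d_V | d_o = k], V being averaged first. *)
Definition nbr_deg_expectation (R : realType) (mu : probability rgraph_space R)
    (k : nat) : \bar R :=
  event_expectation mu (fun x => (nbr_deg_mean R x)%:E) (root_deg_eq k).

(* Main.v *)
(* Let S(v) be the sum of the degrees of the neighbours of v.  Counting
   directed edges from their tails, the ANND at k of a finite graph is the mean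
   over the vertices v of 1{d_v = k} S(v), divided by k times the frequency of
   degree k.  The event {d_v = k, S(v) = j} is read off from the ball of radius
   2, which then has at most 1 + k + j vertices; so it is a finite disjoint
   union of ball types, and its frequency q_j converges in probability to the
   mu-probability p_j of the same event at the root.  The same holds for
   {d_v = k} with balls of radius 1.

   It remains to exchange the limit with the sum of the j q_j.  If d_v = k and
   S(v) > k L, some neighbour of v has degree > L, and S(v) is at most k times
   the sum of the degrees > L among the neighbours of v.  Summing over v, the
   part of the sum of the j q_j with j > k L is at most k times the mean of
   d_w^2 1{d_w > L}, which by Markov's inequality and uniform integrability is
   small in probability, uniformly in n.  Passing to the limit, the same bound
   holds for the tails of the sum of the j p_j. *)

From HB Require Import structures.
Require Import Defs.
From mathcomp Require Import all_boot all_order all_algebra.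
From mathcomp Require Import finmap.
From mathcomp Require Import all_classical all_reals all_analysis.
From mathcomp Require Import measurable_realfun lra.
Set Implicit Arguments.
Unset Strict Implicit.
Unset Printing Implicit Defensive.

Import Order.TTheory GRing.Theory Num.Theory.
Import numFieldNormedType.Exports.
Local Open Scope classical_set_scope.
Local Open Scope ring_scope.

HB.instance Definition _ := gen_eqMixin sgraph.
HB.instance Definition _ := gen_choiceMixin sgraph.

(** * Ball types *)

Lemma nbrs_sub (g : sgraph) (u : nat) : nbrs g u `<=` vert g.
Proof. by move=> w; rewrite /nbrs /= adj_sym => /adj_vert. Qed.

Definition graph_code (g : sgraph) : {fset nat} * {fset (nat * nat)} :=
  (fset_set (vert g), fset_set (dir_edges g)).

Lemma finite_dir_edges (g : sgraph) :
  finite_set (vert g) -> finite_set (dir_edges g).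
Proof.
move=> fg; apply: (@sub_finite_set _ _ (vert g `*` vert g)).
  move=> [u v] /= e; split => /=; first exact: adj_vert e.
  by move: e; rewrite /dir_edges /= adj_sym => /adj_vert.
exact: finite_setX.
Qed.

Lemma sgraph_eq (g g' : sgraph) :
  vert g = vert g' -> (forall u v, adj g u v = adj g' u v) -> g = g'.
Proof.
case: g => V a s i p; case: g' => V' a' s' i' p' /= eV ea.
have {}ea : a = a' by apply/funext => u; apply/funext => v; exact: ea.
by subst; congr SGraph; exact: Prop_irrelevance.
Qed.

Lemma graph_code_inj (g g' : sgraph) : finite_set (vert g) ->
  finite_set (vert g') -> graph_code g = graph_code g' -> g = g'.
Proof.
move=> fg fg' [/fset_set_inj eV /fset_set_inj eE].
apply: sgraph_eq; first exact: eV.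
move=> u v; apply/idP/idP => h.
  have : dir_edges g (u, v) by [].
  by rewrite eE //; exact: finite_dir_edges.
have : dir_edges g' (u, v) by [].
by rewrite -eE //; exact: finite_dir_edges.
Qed.

Lemma finite_locally_finite (g : sgraph) :
  finite_set (vert g) -> locally_finite g.
Proof. by move=> fg v _; exact: sub_finite_set (@nbrs_sub g v) fg. Qed.

Lemma finite_bounded_graphs (N : nat) :
  finite_set [set c : sgraph * nat | vert c.1 `<=` `I_N /\ (c.2 < N)%N].
Proof.
pose A := (fpowerset (fset_set `I_N),
  fpowerset (fset_set (`I_N `*` `I_N : set (nat * nat)))).
pose f (c : sgraph * nat) := (graph_code c.1, c.2).
have fX : finite_set (`I_N `*` `I_N : set (nat * nat)).
  by apply: finite_setX; exact: finite_II.
have fI : finite_set (([set` A.1] `*` [set` A.2]) `*` `I_N).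
  apply: finite_setX; last exact: finite_II.
  by apply: finite_setX; exact: finite_fset.
have fS (c : sgraph * nat) : vert c.1 `<=` `I_N -> finite_set (vert c.1).
  by move=> h; exact: sub_finite_set h (finite_II N).
have : finite_set (f @` [set c : sgraph * nat | vert c.1 `<=` `I_N /\ (c.2 < N)%N]).
  apply: sub_finite_set fI => _ [[g h] /= [sg hN] <-].
  have fg := fS (g, h) sg.
  split => //; split; rewrite /A /= fpowersetE.
    by rewrite -fset_set_sub // finite_II.
  rewrite -fset_set_sub //; last exact: finite_dir_edges.
  move=> [u v] /= e; split => /=; apply: sg; first exact: adj_vert e.
  by move: e; rewrite /dir_edges /= adj_sym => /adj_vert.
rewrite -(@eq_finite_set _ _ [set c : sgraph * nat | vert c.1 `<=` `I_N /\ (c.2 < N)%N]) //.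
rewrite card_eq_sym; apply: inj_card_eq => -[g h] [g' h'] /set_mem[s1 _] /set_mem[s2 _] [].
move=> e1 e2 ->; congr pair; apply: graph_code_inj.
- exact: (fS (g, h)).
- exact: (fS (g', h')).
- by rewrite /graph_code e1 e2.
Qed.

Lemma rooted_iso_sym (G H : sgraph) (o h : nat) :
  vert G o -> rooted_iso G o H h -> rooted_iso H h G o.
Proof.
move=> Go [f [[f1 f2 f3] fo fe]].
have ex y : vert H y -> exists x, vert G x /\ f x = y.
  by move=> /f3 [x Gx <-]; exists x.
pose g y := xget 0%N [set x | vert G x /\ f x = y].
have gP y : vert H y -> vert G (g y) /\ f (g y) = y.
  by move=> /ex[x xP]; rewrite /g; case: xgetP => [z -> //|/(_ x)]; case.
have gf x : vert G x -> g (f x) = x.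
  move=> Gx; have [h1 h2] := gP _ (f1 _ Gx).
  by apply: f2 => //; exact: mem_set.
exists g; split.
- split.
  + by move=> y /gP[].
  + move=> y y' /set_mem /gP[_ h1] /set_mem /gP[_ h2] e.
    by rewrite -h1 e.
  + by move=> x Gx; exists (f x); [exact: f1|exact: gf].
- by rewrite -fo gf.
- move=> u v /gP[g1 g2] /gP[g3 g4].
  by rewrite -fe // g2 g4.
Qed.

Lemma rooted_iso_trans (G H K : sgraph) (o h k : nat) :
  rooted_iso G o H h -> rooted_iso H h K k -> rooted_iso G o K k.
Proof.
move=> [f [[f1 f2 f3] fo fe]] [g [[g1 g2 g3] go ge]].
exists (g \o f); split.
- split.
  + by move=> x /f1 /g1.
  + move=> x y /set_mem Gx /set_mem Gy /= e.
    apply: f2; [exact: mem_set|exact: mem_set|].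
    by apply: g2 => //; apply: mem_set; exact: f1.
  + by move=> z /g3[y /f3[x Gx <-] <-]; exists x.
- by rewrite /= fo.
- by move=> u v Gu Gv /=; rewrite ge ?fe //; exact: f1.
Qed.

Lemma rooted_iso_bounded (B : sgraph) (v : nat) (s : seq nat) (N : nat) :
    vert B v -> (size s <= N)%N -> vert B `<=` [set` s] ->
  exists H h, [/\ vert H `<=` `I_N, vert H h & rooted_iso B v H h].
Proof.
move=> Bv sN Bs; pose f u := index u s.
have fI u w : vert B u -> vert B w -> f u = f w -> u = w.
  move=> /Bs us /Bs ws e.
  by rewrite -[u](nth_index 0%N us) -[w](nth_index 0%N ws); congr nth.
pose a := fun i j => `[< exists u w, [/\ adj B u w, f u = i & f w = j] >].
have as_ : symmetric a.
  move=> i j; apply/asboolP/asboolP => -[u [w [e1 e2 e3]]];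
  by exists w, u; split=> //; rewrite adj_sym.
have adjv u w : adj B u w -> vert B u /\ vert B w.
  by move=> e; split; [exact: adj_vert e|move: e; rewrite adj_sym => /adj_vert].
have ai : irreflexive a.
  move=> i; apply/asboolP => -[u [w [e1 e2 e3]]].
  have [Bu Bw] := adjv _ _ e1.
  have /(fI _ _ Bu Bw) uw : f u = f w by rewrite e2 e3.
  by move: e1; rewrite uw adj_irr.
have av i j : a i j -> (f @` vert B) i.
  by move=> /asboolP[u [w [/adj_vert Bu <- _]]]; exists u.
exists (SGraph as_ ai av), (f v); split => /=.
- move=> _ [u /Bs us <-] /=; apply: leq_trans sN.
  by rewrite index_mem.
- by exists v.
- exists f; split => //.
  + split => /=; first by move=> u Bu; exists u.
      by move=> u w /set_mem Bu /set_mem Bw; exact: fI.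
    by [].
  + move=> u w Bu Bw /=; apply/asboolP/idP => [[u' [w' [e]]]|e].
      have [Bu' Bw'] := adjv _ _ e.
      by move=> /(fI _ _ Bu' Bu) <- /(fI _ _ Bw' Bw) <-.
    by exists u, w.
Qed.

Lemma ball_graph_root (G : sgraph) (r v : nat) :
  vert G v -> vert (ball_graph G r v) v.
Proof. by move=> Gv; split => //; exists [::]; split. Qed.

Lemma ball_graph_locally_finite (G : sgraph) (r v : nat) :
  locally_finite G -> locally_finite (ball_graph G r v).
Proof.
move=> lG u [Gu _]; apply: sub_finite_set (lG _ Gu) => w.
by rewrite /nbrs /= => /and3P[].
Qed.

(* Keeping one representative per isomorphism class makes the sum of the
   indicators at most 1. *)
Lemma class_representatives (s : seq (sgraph * nat)) :
    (forall c, c \in s -> vert c.1 c.2) ->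
  exists s' : seq (sgraph * nat), {subset s' <= s} /\
    forall B v, vert B v ->
      (`[< exists2 c, c \in s & rooted_iso B v c.1 c.2 >] : nat) =
      (\sum_(c <- s') `[< rooted_iso B v c.1 c.2 >])%N.
Proof.
elim: s => [_|x s IH sv].
  exists [::]; split => // B v _; rewrite big_nil.
  by case: asboolP => // -[].
have /IH[s' [ss' s'E]] : forall c, c \in s -> vert c.1 c.2.
  by move=> c cs; apply: sv; rewrite inE cs orbT.
have vx : vert x.1 x.2 by apply: sv; rewrite inE eqxx.
have [[c cs xc]|nx] := pselect (exists2 c, c \in s & rooted_iso x.1 x.2 c.1 c.2).
  exists s'; split.
    by move=> y /ss' ys; rewrite inE ys orbT.
  move=> B v Bv; rewrite -s'E //; congr nat_of_bool; congr asbool.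
  apply/propext; split => -[y].
    rewrite inE => /predU1P[->|ys] Bx; last by exists y.
    by exists c => //; exact: rooted_iso_trans Bx xc.
  by move=> ys Bx; exists y => //; rewrite inE ys orbT.
exists (x :: s'); split.
  by move=> y; rewrite !inE => /predU1P[->|/ss' ->]; rewrite ?eqxx ?orbT.
move=> B v Bv; rewrite big_cons -s'E //.
case: (asboolP (rooted_iso B v x.1 x.2)) => Bx.
  rewrite asboolT; last by exists x; rewrite ?inE ?eqxx.
  rewrite asboolF // => -[c cs Bc]; apply: nx; exists c => //.
  by apply: rooted_iso_trans Bc; exact: rooted_iso_sym.
rewrite add0n; congr nat_of_bool; congr asbool.
apply/propext; split => -[y].
  by rewrite inE => /predU1P[->|ys] // By; exists y.
by move=> ys By; exists y => //; rewrite inE ys orbT.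
Qed.

Lemma ball_property_types (r N : nat) (Q : sgraph -> nat -> Prop) :
    (forall G v H h, locally_finite G -> vert G v -> rooted_iso G v H h ->
      Q G v -> Q H h) ->
    (forall G v, Q (ball_graph G r v) v <-> Q G v) ->
    (forall G v, locally_finite G -> vert G v -> Q G v ->
      exists2 s : seq nat, (size s <= N)%N &
        vert (ball_graph G r v) `<=` [set` s]) ->
  exists2 s : seq (sgraph * nat), (forall c, c \in s -> vert c.1 c.2) &
    forall G v, locally_finite G -> vert G v ->
      (`[< Q G v >] : nat) =
      (\sum_(c <- s) `[< rooted_iso (ball_graph G r v) v c.1 c.2 >])%N.
Proof.
move=> Qiso Qball Qfin.
pose X := [set c : sgraph * nat | vert c.1 `<=` `I_N /\ (c.2 < N)%N].
pose Y := X `&` [set c | vert c.1 c.2 /\ Q c.1 c.2].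
have : finite_set Y by apply: finite_setIl; exact: finite_bounded_graphs.
move=> /finite_seqP[s0 Ys0].
have s0P c : c \in s0 -> Y c by rewrite Ys0.
have [c /s0P[_ []] //|s [ss0 sE]] := @class_representatives s0.
exists s; first by move=> c /ss0 /s0P[_ []].
move=> G v lG Gv; rewrite -sE; last exact: ball_graph_root.
congr nat_of_bool; congr asbool; apply/propext; split.
  move=> QG; have [t tN Bt] := Qfin _ _ lG Gv QG.
  have [H [h [HN Hh iso]]] := rooted_iso_bounded (ball_graph_root r Gv) tN Bt.
  exists (H, h) => //.
  suff : Y (H, h) by rewrite Ys0.
  split; first by split => //; exact: HN.
  split => //; apply: Qiso iso _ => //; last exact/Qball.
    exact: ball_graph_locally_finite.
  exact: ball_graph_root.
move=> [[H h] /s0P[[/= HN _] [/= Hh QH]] iso].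
apply/(Qball _ _); apply: (Qiso H h) => //.
  by apply: finite_locally_finite; apply: sub_finite_set HN (finite_II _).
by apply: rooted_iso_sym => //; exact: ball_graph_root.
Qed.

Definition nbr_deg_sum (G : sgraph) (v : nat) : nat :=
  \sum_(u <- fset_set (nbrs G v)) deg G u.

Section iso_invariance.
Variables (G H : sgraph) (f : nat -> nat).
Hypothesis lG : locally_finite G.
Hypothesis fbij : set_bij (vert G) (vert H) f.
Hypothesis fadj :
  forall u v, vert G u -> vert G v -> adj H (f u) (f v) = adj G u v.

Lemma iso_nbrs u : vert G u -> nbrs H (f u) = f @` nbrs G u.
Proof.
move=> Gu; case: fbij => f1 f2 f3; apply/seteqP; split => [y|_ [w uw <-]].
  rewrite /nbrs /= => e; have /f3[w Gw fw] : vert H y.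
    by move: e; rewrite adj_sym => /adj_vert.
  by exists w => //; rewrite -fw fadj // in e.
by rewrite /nbrs /= fadj //; exact: nbrs_sub uw.
Qed.

Let f_inj u : vert G u -> {in fset_set (nbrs G u) &, injective f}.
Proof.
move=> Gu x y; rewrite !in_fset_set ?lG//; try exact: lG.
move=> /set_mem /nbrs_sub Gx /set_mem /nbrs_sub Gy.
by case: fbij => _ f2 _; apply: f2; exact: mem_set.
Qed.

Lemma iso_deg u : vert G u -> deg H (f u) = deg G u.
Proof.
move=> Gu; rewrite /deg iso_nbrs // /ncard fset_set_image; last exact: lG.
by rewrite card_in_imfset //; exact: f_inj.
Qed.

Lemma iso_nbr_deg_sum u : vert G u -> nbr_deg_sum H (f u) = nbr_deg_sum G u.
Proof.
move=> Gu; rewrite /nbr_deg_sum iso_nbrs // fset_set_image; last exact: lG.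
rewrite big_imfset /=; last exact: f_inj.
rewrite [LHS]big_seq [RHS]big_seq; apply: eq_bigr => w.
by rewrite in_fset_set ?lG //; [move=> /set_mem /nbrs_sub /iso_deg|exact: lG].
Qed.

End iso_invariance.

Lemma ball_nbrs (G : sgraph) (r v w : nat) :
  dist_le G r v w -> nbrs (ball_graph G r.+1 v) w = nbrs G w.
Proof.
move=> [p [pp lp sp]]; apply/seteqP; split => u; rewrite /nbrs /=.
  by case/and3P.
move=> e; rewrite e /=; apply/andP; split; apply: mem_set.
  by exists p; split => //; exact: ltnW.
exists (rcons p u); split; last by rewrite size_rcons.
  by rewrite rcons_path pp lp.
by rewrite last_rcons.
Qed.

Lemma dist_le0 (G : sgraph) (r v : nat) : dist_le G r v v.
Proof. by exists [::]; split. Qed.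

Lemma dist_le1 (G : sgraph) (v w : nat) : adj G v w -> dist_le G 1 v w.
Proof. by move=> e; exists [:: w]; split => //=; rewrite e. Qed.

Lemma ball_deg (G : sgraph) (r v w : nat) :
  dist_le G r v w -> deg (ball_graph G r.+1 v) w = deg G w.
Proof. by move=> h; rewrite /deg ball_nbrs. Qed.

Lemma ball_nbr_deg_sum (G : sgraph) (v : nat) :
  nbr_deg_sum (ball_graph G 2 v) v = nbr_deg_sum G v.
Proof.
rewrite /nbr_deg_sum ball_nbrs; last exact: dist_le0.
have [fN|nfN] := pselect (finite_set (nbrs G v)).
  rewrite [LHS]big_seq [RHS]big_seq; apply: eq_bigr => w.
  by rewrite in_fset_set // => /set_mem vw; apply: ball_deg; exact: dist_le1.
by rewrite /fset_set; case: pselect => // h; rewrite !big_nil.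
Qed.

Lemma deg_types (k : nat) :
  exists2 s : seq (sgraph * nat), (forall c, c \in s -> vert c.1 c.2) &
    forall G v, locally_finite G -> vert G v ->
      (deg G v == k : nat) =
      (\sum_(c <- s) `[< rooted_iso (ball_graph G 1 v) v c.1 c.2 >])%N.
Proof.
have [| | |s sv sE] := @ball_property_types 1 k.+1 (fun G v => deg G v = k).
- move=> G v H h lG Gv [f [fb <- fe]] <-; exact: iso_deg.
- by move=> G v; rewrite ball_deg //; exact: dist_le0.
- move=> G v lG Gv dk; exists (v :: fset_set (nbrs G v)).
    by rewrite /= -dk.
  move=> w [_ [[|a [|b t]] []]] //= p <- _; rewrite inE ?eqxx//.
  rewrite andbT in p; rewrite in_fset_set; last exact: lG.
  by rewrite mem_set ?orbT.
- exists s => // G v lG Gv; rewrite -sE //; congr nat_of_bool.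
  by apply/eqP/asboolP.
Qed.

Lemma deg_sum_types (k j : nat) :
  exists2 s : seq (sgraph * nat), (forall c, c \in s -> vert c.1 c.2) &
    forall G v, locally_finite G -> vert G v ->
      ((deg G v == k) && (nbr_deg_sum G v == j) : nat) =
      (\sum_(c <- s) `[< rooted_iso (ball_graph G 2 v) v c.1 c.2 >])%N.
Proof.
have [| | |s sv sE] := @ball_property_types 2 (k + j).+1
  (fun G v => deg G v = k /\ nbr_deg_sum G v = j).
- move=> G v H h lG Gv [f [fb <- fe]] [<- <-]; split; first exact: iso_deg.
  exact: iso_nbr_deg_sum.
- by move=> G v; rewrite ball_nbr_deg_sum ball_deg //; exact: dist_le0.
- move=> G v lG Gv [dk Sj].
  exists (v :: fset_set (nbrs G v) ++
    flatten [seq (fset_set (nbrs G w) : seq nat) | w <- fset_set (nbrs G v)]).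
    rewrite /= size_cat -dk -Sj size_flatten /shape -map_comp sumnE big_map.
    by rewrite ltnS leq_add2l.
  have Gn w u : adj G u w -> vert G w by rewrite adj_sym => /adj_vert.
  have inN u w : adj G u w -> w \in fset_set (nbrs G u).
    by move=> e; rewrite in_fset_set ?mem_set //; apply: lG; exact: adj_vert e.
  move=> w [_ [[|a [|b [|c t]]] []]] //= p <- _; rewrite inE ?eqxx// mem_cat.
    by rewrite andbT in p; rewrite inN ?orbT.
  case/and3P: p => p1 p2 _; apply/orP; right; apply/orP; right.
  by apply/flattenP; exists (fset_set (nbrs G a) : seq nat); [exact/map_f/inN|exact: inN].
- exists s => // G v lG Gv; rewrite -sE //; congr nat_of_bool.
  by apply/andP/asboolP => -[/eqP ? /eqP ?].
Qed.

(** * Finite graphs and the ANND *)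

Lemma leq_sum_seq1 (T : eqType) (s : seq T) (p : pred T) (f : T -> nat) (x : T) :
  x \in s -> p x -> (f x <= \sum_(y <- s | p y) f y)%N.
Proof. by move=> xs px; rewrite (big_rem x) //= px leq_addr. Qed.

Lemma leq_sum_bound (T : eqType) (s : seq T) (f : T -> nat) (B : nat) :
  (forall x, x \in s -> f x <= B)%N -> (\sum_(x <- s) f x <= size s * B)%N.
Proof.
move=> h; rewrite big_seq; apply: (@leq_trans (\sum_(x <- s | x \in s) B)).
  exact: leq_sum.
by rewrite -big_seq big_const_seq count_predT iter_addn_0 mulnC.
Qed.

(* If the sum exceeds [size s * L], some term exceeds [L], so every term is at
   most the sum of the terms exceeding [L]. *)
Lemma leq_sum_large_terms (T : eqType) (s : seq T) (f : T -> nat) (L : nat) :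
  (size s * L < \sum_(x <- s) f x)%N ->
  (\sum_(x <- s) f x <= size s * \sum_(x <- s | L < f x) f x)%N.
Proof.
move=> sL; have /hasP[x0 x0s Lx0] : has (fun x => L < f x)%N s.
  apply: contraLR sL => /hasPn h; rewrite -leqNgt; apply: leq_sum_bound => x xs.
  by rewrite leqNgt h.
apply: leq_sum_bound => x xs; have [xL|Lx] := leqP (f x) L.
  apply: (leq_trans xL); apply: (leq_trans (ltnW Lx0)).
  exact: (@leq_sum_seq1 _ s (fun x => L < f x)%N).
exact: (@leq_sum_seq1 _ s (fun x => L < f x)%N).
Qed.

Section finite_graph.
Variable g : sgraph.
Hypothesis fg : finite_set (vert g).

Let V : seq nat := fset_set (vert g).

Lemma finite_nbrs (u : nat) : finite_set (nbrs g u).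
Proof. exact: sub_finite_set (@nbrs_sub _ _) fg. Qed.

Lemma sum_nbrs (u : nat) (F : nat -> nat) :
  (\sum_(w <- fset_set (nbrs g u)) F w = \sum_(w <- V | adj g u w) F w)%N.
Proof.
rewrite -[RHS]big_filter; apply: perm_big; apply: uniq_perm => //.
  by rewrite filter_uniq // fset_uniq.
move=> w; rewrite mem_filter in_fset_set; last exact: finite_nbrs.
rewrite /V in_fset_set //; apply/idP/andP => [/set_mem h|[h _]]; last exact: mem_set.
by split => //; apply: mem_set; exact: nbrs_sub h.
Qed.

Lemma sum_dir_edges (F : nat * nat -> nat) :
  (\sum_(e <- fset_set (dir_edges g)) F e =
   \sum_(u <- V) \sum_(w <- fset_set (nbrs g u)) F (u, w))%N.
Proof.
transitivity (\sum_(e <- [seq (u, w) | u <- V, w <- V] | adj g e.1 e.2) F e)%N.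
  rewrite -[RHS]big_filter; apply: perm_big; apply: uniq_perm => //.
    by rewrite filter_uniq // allpairs_uniq ?fset_uniq // => -[? ?] [? ?].
  move=> [u w]; rewrite mem_filter in_fset_set; last exact: finite_dir_edges.
  rewrite /=; apply/idP/andP => [/set_mem h|[h _]]; last exact: mem_set.
  split => //; apply/allpairsP; exists (u, w); rewrite /V !in_fset_set//=.
  by split=> //; apply: mem_set; [exact: adj_vert h|exact: nbrs_sub h].
rewrite big_mkcond big_allpairs /=; apply: eq_bigr => u _.
by rewrite sum_nbrs [RHS]big_mkcond.
Qed.

Lemma sum_edges_fst (k : nat) :
  (\sum_(e <- fset_set (dir_edges g)) (deg g e.1 == k) =
   k * \sum_(v <- V) (deg g v == k))%N.
Proof.
rewrite sum_dir_edges big_distrr; apply: eq_bigr => u _ /=.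
rewrite big_const_seq count_predT iter_addn_0 -/(ncard _) -/(deg g u).
by case: eqP => [->|_]; rewrite ?mul0n ?muln0 ?mul1n ?muln1.
Qed.

Lemma sum_edges_snd (k : nat) :
  (\sum_(e <- fset_set (dir_edges g)) (deg g e.1 == k) * deg g e.2 =
   \sum_(v <- V) (deg g v == k) * nbr_deg_sum g v)%N.
Proof.
by rewrite sum_dir_edges; apply: eq_bigr => u _; rewrite /nbr_deg_sum big_distrr.
Qed.

(* Both sides count the paths [v - w - u] with [deg w > L]. *)
Lemma sum_nbrs_large (L : nat) :
  (\sum_(v <- V) \sum_(w <- fset_set (nbrs g v) | L < deg g w) deg g w =
   \sum_(w <- V) (L < deg g w) * deg g w ^ 2)%N.
Proof.
transitivity (\sum_(v <- V) \sum_(w <- V | adj g v w)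
                (L < deg g w) * deg g w)%N.
  apply: eq_bigr => v _; rewrite big_mkcond sum_nbrs.
  by apply: eq_bigr => w _; case: ltnP; rewrite ?mul1n ?mul0n.
rewrite (exchange_big_dep predT) //=; apply: eq_bigr => w _.
under eq_bigl do rewrite adj_sym.
rewrite -[X in X = _](sum_nbrs w (fun=> (L < deg g w) * deg g w)%N).
by rewrite big_const_seq count_predT iter_addn_0 -mulnA mulnn.
Qed.

Lemma sum_large_nbr_deg_sum (k L : nat) :
  (\sum_(v <- V) ((deg g v == k) && (k * L < nbr_deg_sum g v)) * nbr_deg_sum g v
   <= k * \sum_(w <- V) (L < deg g w) * deg g w ^ 2)%N.
Proof.
rewrite -sum_nbrs_large big_distrr; apply: leq_sum => v _ /=.
case: eqP => [dk|_]; last by rewrite mul0n.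
case: ltnP => [kL|_]; last by rewrite mul0n.
rewrite mul1n -dk; apply: leq_sum_large_terms.
by rewrite -/(ncard _) -/(deg g v) dk.
Qed.

End finite_graph.

Section vertex_mean.
Variable R : realType.
Implicit Types (g : sgraph) (F : nat -> nat).

(* As [deg_pmf] and [ball_freq], this is 0 on infinite graphs. *)
Definition vmean g F : R :=
  (ncard (vert g))%:R^-1 * (\sum_(v <- fset_set (vert g)) F v)%N%:R.

Lemma ncard_infinite (T : choiceType) (A : set T) : infinite_set A -> ncard A = 0%N.
Proof.
move=> iA; rewrite /ncard; suff -> : fset_set A = fset0 by rewrite cardfs0.
by rewrite /fset_set; case: pselect.
Qed.

Lemma vmean_infinite g F : infinite_set (vert g) -> vmean g F = 0.
Proof. by move=> /ncard_infinite; rewrite /vmean => ->; rewrite invr0 mul0r. Qed.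

Lemma vmeanE g (F : nat -> bool) :
  (ncard (vert g))%:R^-1 * \sum_(v \in vert g) ((F v)%:R : R) =
  vmean g (fun v => F v).
Proof.
have [fg|ig] := pselect (finite_set (vert g)); last first.
  by rewrite vmean_infinite // ncard_infinite // invr0 mul0r.
by rewrite /vmean natr_sum fsbig_finite.
Qed.

Lemma deg_pmfE g k : deg_pmf R g k = vmean g (fun v => deg g v == k).
Proof. exact: vmeanE. Qed.

Lemma ball_freqE g r H h :
  ball_freq R g r H h = vmean g (fun v => `[< rooted_iso (ball_graph g r v) v H h >]).
Proof. exact: vmeanE. Qed.

Lemma vmean_ge0 g F : 0 <= vmean g F.
Proof. by rewrite mulr_ge0 // invr_ge0. Qed.

Lemma eq_vmean g F F' : (forall v, vert g v -> finite_set (vert g) -> F v = F' v) ->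
  vmean g F = vmean g F'.
Proof.
have [fg|ig] := pselect (finite_set (vert g)); last by rewrite !vmean_infinite.
move=> FF'; congr (_ * _%:R); rewrite [LHS]big_seq [RHS]big_seq.
by apply: eq_bigr => v; rewrite in_fset_set // => /set_mem vg; exact: FF'.
Qed.

Lemma vmean_sum (I : Type) (s : seq I) (F : I -> nat -> nat) g :
  vmean g (fun v => \sum_(i <- s) F i v)%N = \sum_(i <- s) vmean g (F i).
Proof.
by rewrite /vmean exchange_big natr_sum mulr_sumr.
Qed.

Lemma vmeanD g F F' : vmean g (fun v => F v + F' v)%N = vmean g F + vmean g F'.
Proof. by rewrite /vmean big_split natrD mulrDr. Qed.

Lemma vmeanZ g c F : vmean g (fun v => c * F v)%N = c%:R * vmean g F.
Proof. by rewrite /vmean -big_distrr natrM mulrCA. Qed.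

Lemma le_vmean g F F' : (forall v, F v <= F' v)%N -> vmean g F <= vmean g F'.
Proof.
move=> FF'; apply: ler_wpM2l; first by rewrite invr_ge0.
by rewrite ler_nat; apply: leq_sum.
Qed.

Lemma anndE g k : (0 < k)%N ->
  annd R g k = vmean g (fun v => (deg g v == k) * nbr_deg_sum g v)%N /
               (k%:R * vmean g (fun v => deg g v == k)).
Proof.
move=> k0; rewrite /annd deg_pmfE.
set D := vmean g (fun v => deg g v == k).
have [D0|] := ltP 0 D; last first.
  move=> D0; have -> : D = 0 by apply/eqP; rewrite eq_le D0 vmean_ge0.
  by rewrite mul0r mulr0 invr0 mulr0.
have fg : finite_set (vert g).
  by apply: contrapT => /vmean_infinite D00; move: D0; rewrite /D D00 ltxx.
have fE := finite_dir_edges fg.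
rewrite mul1r /deg_pmf_star /deg_joint.
set E := (ncard (dir_edges g))%:R^-1 : R.
have N0 : (ncard (vert g))%:R^-1 != 0 :> R.
  by apply: contraTneq D0; rewrite /D /vmean => ->; rewrite mul0r ltxx.
have Dn0 : (\sum_(v <- fset_set (vert g)) (deg g v == k) != 0)%N.
  by apply: contraTneq D0; rewrite /D /vmean => ->; rewrite mulr0 ltxx.
have E0 : E != 0.
  rewrite invr_neq0 // pnatr_eq0; apply: contraNneq Dn0 => E0.
  have := sum_edges_fst fg k; move/cardfs0_eq : E0 => ->; rewrite big_nil.
  by move=> /esym/eqP; rewrite muln_eq0 -leqn0 leqNgt k0.
rewrite [X in _ / (_ * X)]fsbig_finite // -natr_sum sum_edges_fst // natrM.
have -> : \sum_(l \in [set l | (0 < l)%N]) l%:R * (E *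
     \sum_(e \in dir_edges g) (((deg g e.1 == k) && (deg g e.2 == l))%:R : R)) =
   E * (\sum_(v <- fset_set (vert g)) (deg g v == k) * nbr_deg_sum g v)%N%:R :> R.
  rewrite -sum_edges_snd //.
  pose B := (\sum_(e <- fset_set (dir_edges g)) deg g e.2)%N.
  pose h (l : nat) : R := l%:R * (E *
     \sum_(e \in dir_edges g) (((deg g e.1 == k) && (deg g e.2 == l))%:R : R)).
  rewrite -/h.
  have h0 l : (B < l)%N -> h l = 0.
    move=> Bl; rewrite /h fsbig_finite // big_seq big1 ?mulr0 // => e eE.
    case: (deg g e.2 =P l) => [el|_]; last by rewrite andbF.
    have := @leq_sum_seq1 _ (fset_set (dir_edges g)) predT (fun e => deg g e.2) e eE isT.
    by rewrite el -/B leqNgt Bl.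
  rewrite (_ : \sum_(l \in _) _ = \sum_(l \in `I_B.+1) h l); last first.
    rewrite (fsbig_widen _ setT) //; last first.
      by move=> [|l] [_ /= l0] //=; rewrite ?mul0r.
    rewrite [RHS](fsbig_widen _ setT) // => l [_ /= /negP lB]; apply: h0.
    by rewrite leqNgt.
  rewrite -fsbig_ord /h /=.
  under eq_bigr do rewrite mulrCA fsbig_finite //= -natr_sum -natrM.
  rewrite -mulr_sumr -natr_sum; congr (_ * _%:R).
  under eq_bigr do rewrite big_distrr /=.
  rewrite exchange_big /= [LHS]big_seq [RHS]big_seq; apply: eq_bigr => e eE.
  have eB : (deg g e.2 < B.+1)%N by exact: (@leq_sum_seq1 _ _ predT (fun e => deg g e.2)).
  rewrite (bigD1 (Ordinal eB)) //= eqxx andbT big1 ?addn0 1?mulnC // => i.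
  by rewrite -val_eqE /= eq_sym => /negbTE ->; rewrite andbF muln0.
rewrite -mulf_div divff // mul1r /D /vmean [k%:R * (_ * _)]mulrCA -[RHS]mulf_div.
by rewrite divff // mul1r.
Qed.

Definition deg_sum_freq g (k j : nat) : R :=
  vmean g (fun v => (deg g v == k) && (nbr_deg_sum g v == j)).

Definition large_sq_mean g (L : nat) : R :=
  vmean g (fun v => (L < deg g v) * deg g v ^ 2)%N.

Lemma le_tail_large_sq_mean g k L :
  vmean g (fun v => ((deg g v == k) && (k * L < nbr_deg_sum g v)) * nbr_deg_sum g v)%N
  <= k%:R * large_sq_mean g L.
Proof.
have [fg|ig] := pselect (finite_set (vert g)); last first.
  by rewrite /large_sq_mean !vmean_infinite // mulr0.
rewrite /large_sq_mean /vmean mulrCA; apply: ler_wpM2l; first by rewrite invr_ge0.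
by rewrite -natrM ler_nat; exact: sum_large_nbr_deg_sum.
Qed.

Lemma sum_deg_sum_freq g k m M :
  \sum_(m <= j < M) j%:R * deg_sum_freq g k j =
  vmean g (fun v => ((deg g v == k) && (m <= nbr_deg_sum g v < M)) * nbr_deg_sum g v)%N.
Proof.
under eq_bigr do rewrite -vmeanZ.
rewrite -vmean_sum; apply: eq_vmean => v _ _.
case: (deg g v == k) => /=; last by rewrite big1 ?mul0n// => i; rewrite muln0.
case: (boolP (m <= nbr_deg_sum g v < M)%N) => h.
  rewrite (bigD1_seq (nbr_deg_sum g v)) ?iota_uniq ?mem_index_iota //=.
  rewrite eqxx muln1 mul1n big1 ?addn0 // => i.
  by rewrite eq_sym => /negbTE ->; rewrite muln0.
rewrite mul0n big_seq big1 // => i; rewrite mem_index_iota => hi.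
by case: eqP => [e|]; rewrite ?muln0 //; rewrite e hi in h.
Qed.

Lemma truncated_mean_error g k L :
  0 <= vmean g (fun v => (deg g v == k) * nbr_deg_sum g v)%N -
       \sum_(0 <= j < (k * L).+1) j%:R * deg_sum_freq g k j
    <= k%:R * large_sq_mean g L.
Proof.
set A := vmean _ _; set t := \sum_(_ <= j < _) _.
suff -> : A - t =
  vmean g (fun v => ((deg g v == k) && (k * L < nbr_deg_sum g v)) * nbr_deg_sum g v)%N.
  by rewrite vmean_ge0 le_tail_large_sq_mean.
apply/eqP; rewrite subr_eq /t sum_deg_sum_freq -vmeanD; apply/eqP.
apply: eq_vmean => v _ _; rewrite leq0n /= ltnS.
by case: (deg g v == k); case: leqP; rewrite ?mul1n ?mul0n ?addn0.
Qed.

Lemma le_sum_deg_sum_freq g k L M :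
  \sum_((k * L).+1 <= j < M) j%:R * deg_sum_freq g k j <= k%:R * large_sq_mean g L.
Proof.
apply: le_trans (le_tail_large_sq_mean g k L).
rewrite sum_deg_sum_freq; apply: le_vmean => v; rewrite leq_mul2r.
by case: (deg g v == k); case: (k * L < _)%N; case: (_ < M)%N; rewrite /= ?orbT.
Qed.

End vertex_mean.

(** * Random finite graphs *)

Section discrete.
Context (R : realType) (d : measure_display) (T : measurableType d).

Lemma measurable_discrete (S : Type) (D : set S) (c : S -> nat) (X : T -> S) :
    {in D &, injective c} ->
    (forall s, D s -> measurable [set w | X w = s]) ->
  forall Q : set S, measurable [set w | D (X w) /\ Q (X w)].
Proof.
move=> cI mX Q.
rewrite (_ : [set _ | _] = \bigcup_i [set w | (D `&` Q) (X w) /\ c (X w) = i]).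
  apply: bigcupT_measurable => i.
  have [[s [[Ds Qs] <-]]|nex] := pselect (exists s, (D `&` Q) s /\ c s = i).
    rewrite (_ : [set _ | _] = [set w | X w = s]); first exact: mX.
    apply/seteqP; split => w /= => [[[Dw _]]|->//].
    by apply: cI; exact: mem_set.
  rewrite (_ : [set _ | _] = set0); first exact: measurable0.
  by apply/seteqP; split => w //= h; apply: nex; exists (X w).
by apply/seteqP; split => [w [h1 h2]|w [i _ [[]]]] //; exists (c (X w)).
Qed.

Lemma measure_sum_indicator (mu : {measure set T -> \bar R}) (I : eqType)
    (s : seq I) (F : I -> set T) (A : set T) :
    (forall c, c \in s -> measurable (F c)) ->
    (forall x, (`[< A x >] : nat) = (\sum_(c <- s) `[< F c x >])%N) ->
  measurable A /\ mu A = (\sum_(c <- s) mu (F c))%E.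
Proof.
elim: s A => [A _ h|c s IH A mF h].
  rewrite big_nil (_ : A = set0) ?measure0 //; apply/seteqP; split => // x Ax.
  by have := h x; rewrite big_nil asboolT.
have mFc : measurable (F c) by apply: mF; rewrite inE eqxx.
have [| |mA' eA'] := IH (A `\` F c).
- by move=> e es; apply: mF; rewrite inE es orbT.
- move=> x; have := h x; rewrite big_cons.
  case: (asboolP (F c x)) => Fx; case: (asboolP (A x)) => Ax.
  + by rewrite asboolF => [|[]//]; rewrite add1n => -[].
  + by [].
  + by rewrite asboolT // add0n.
  + by rewrite asboolF => [|[]//]; rewrite add0n.
have FA : F c `<=` A.
  by move=> x Fx; have := h x; rewrite big_cons (asboolT Fx); case: asboolP.
have eA : A = F c `|` (A `\` F c) by rewrite setDUK.
split; first by rewrite eA; exact: measurableU.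
rewrite big_cons -eA' {1}eA measureU //.
by apply/seteqP; split => // x [? []].
Qed.

Lemma ge0_integral_pieces (mu : {measure set T -> \bar R}) (F : (set T)^nat)
    (c : nat -> R) (f : T -> R) :
    (forall i, measurable (F i)) -> trivIset setT F -> (forall i, 0 <= c i) ->
    (forall i w, F i w -> f w = c i) ->
  (\int[mu]_(w in \bigcup_i F i) (f w)%:E = \sum_(i <oo) (c i)%:E * mu (F i))%E.
Proof.
move=> mF tF c0 fc; rewrite ge0_integral_bigcup //.
- apply: eq_eseriesr => i _.
  rewrite (eq_integral (cst (c i)%:E)); first by rewrite integral_cst.
  by move=> w /set_mem Fw; rewrite (fc i).
- apply/measurable_fun_bigcup => // i.
  apply: (eq_measurable_fun (cst (c i)%:E)); last exact: measurable_cst.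
  by move=> w /set_mem Fw; rewrite (fc i).
- by move=> w [i _ Fw]; rewrite (fc i) // lee_fin.
Qed.

(* No measurability of [f] on [B]: the integral of a nonnegative function is
   the supremum over the simple functions below it. *)
Lemma ge0_subset_integral_lower (mu : {measure set T -> \bar R})
    (A B : set T) (f : T -> \bar R) :
    (forall w, 0 <= f w)%E -> A `<=` B ->
  (\int[mu]_(w in A) f w <= \int[mu]_(w in B) f w)%E.
Proof.
move=> f0 AB; rewrite !ge0_integralE //; apply: le_ereal_sup => _ [h hf <-].
exists h => // w; apply: le_trans (hf w) _; rewrite /patch.
case: ifPn => [/set_mem /AB Bw|_]; first by rewrite mem_set.
by case: ifP.
Qed.

End discrete.

Section random_finite_graph.
Context (R : realType) (d : measure_display) (T : measurableType d).
Variables (P : probability T R) (G : T -> sgraph).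
Hypothesis hG : random_graph P G.

Definition graph_event (Q : set sgraph) : set T :=
  [set w | finite_set (vert (G w)) /\ Q (G w)].

Lemma pickle_graph_code_inj :
  {in [set g : sgraph | finite_set (vert g)] &,
    injective (fun g => choice.pickle (graph_code g))}.
Proof.
move=> g g' /set_mem fg /set_mem fg' /(pcan_inj choice.pickleK).
exact: graph_code_inj.
Qed.

Lemma measurable_graph_event (Q : set sgraph) : measurable (graph_event Q).
Proof. exact: (measurable_discrete pickle_graph_code_inj hG.1). Qed.

Definition graph_prob (Q : set sgraph) : \bar R := P (graph_event Q).

Lemma le_graph_prob (Q Q' : set sgraph) :
    (forall g, finite_set (vert g) -> Q g -> Q' g) ->
  (graph_prob Q <= graph_prob Q')%E.
Proof.
move=> QQ'; apply: le_measure; rewrite ?inE; try exact: measurable_graph_event.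
by move=> w [fw Qw]; split => //; exact: QQ'.
Qed.

Lemma graph_probU (Q Q' : set sgraph) :
  (graph_prob (Q `|` Q') <= graph_prob Q + graph_prob Q')%E.
Proof.
apply: le_trans (@measureU2 _ _ _ P _ _ (measurable_graph_event Q)
  (measurable_graph_event Q')).
apply: le_measure; rewrite ?inE; [exact: measurable_graph_event| |].
  by apply: measurableU; exact: measurable_graph_event.
by move=> w [fw [|]]; [left|right].
Qed.

Let infinite_eventE :
  [set w | infinite_set (vert (G w))] = ~` graph_event setT.
Proof. by apply/seteqP; split => w /= h; [case|move=> fw; apply: h]. Qed.

Let P_infinite : P [set w | infinite_set (vert (G w))] = 0%E.
Proof.
apply: measure_negligible; last exact: hG.2.
by rewrite infinite_eventE; apply: measurableC; exact: measurable_graph_event.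
Qed.

Lemma graph_probT : graph_prob setT = 1%E.
Proof.
have mT := measurable_graph_event setT.
have := P_infinite; rewrite infinite_eventE probability_setC // => h.
have /eqP := h; rewrite sube_eq ?fin_num_measure // ?fin_num_adde_defl //.
by rewrite add0e => /eqP.
Qed.

Lemma prob_deviation (F : sgraph -> R) (c e : R) :
    (forall g, infinite_set (vert g) -> F g = 0) ->
  P [set w | e < `|F (G w) - c|] = graph_prob [set g | e < `|F g - c|].
Proof.
move=> F0; rewrite /graph_prob; set Q : set sgraph := [set g | _].
have [e0|e0] := boolP (e < `|0 - c|); last first.
  congr (P _); apply/seteqP; split => w /=; last by case.
  by move=> h; split => //; apply: contrapT => /F0 F0w; rewrite /= F0w (negPf e0) in h.
rewrite (_ : [set w | _] = graph_event Q `|` [set w | infinite_set (vert (G w))]).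
  have mQ := measurable_graph_event Q.
  have mI : measurable [set w | infinite_set (vert (G w))].
    by rewrite infinite_eventE; apply: measurableC; exact: measurable_graph_event.
  rewrite measureU //; last by apply/seteqP; split => // w [[]].
  by rewrite -[RHS]adde0; congr (_ + _)%E; exact: P_infinite.
apply/seteqP; split => w /=.
  by have [fw|iw] := pselect (finite_set (vert (G w))); [left|right].
by move=> [[]|/F0 ->].
Qed.

End random_finite_graph.

Section markov.
Context (R : realType) (d : measure_display) (T : measurableType d).
Variables (P : probability T R) (G : T -> sgraph) (o : T -> nat).
Hypotheses (hG : random_graph P G) (ho : uniform_vertex P G o).

Let measurable_Go (Q : set (sgraph * nat)) :
  measurable [set w | finite_set (vert (G w)) /\ Q (G w, o w)].
Proof.
apply: (@measurable_discrete _ _ _ [set c : sgraph * nat | finite_set (vert c.1)]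
  (fun c => choice.pickle (graph_code c.1, c.2)) (fun w => (G w, o w))).
  move=> [g v] [g' v'] /set_mem fg /set_mem fg' /(pcan_inj choice.pickleK)/= [e1 e2 ->].
  by congr pair; apply: graph_code_inj => //; rewrite /graph_code e1 e2.
move=> [g v] /= fg; have [mgv _] := ho fg v.
by congr measurable: mgv; apply/seteqP; split => w /= [-> ->].
Qed.

Let tail L := [set w | [/\ finite_set (vert (G w)), vert (G w) (o w) &
                          (L < deg (G w) (o w))%N]].

Let integral_one_graph L g : finite_set (vert g) ->
  (P [set w | G w = g] * (large_sq_mean R g L)%:E <=
   \int[P]_(w in tail L `&` [set w | G w = g]) ((deg (G w) (o w))%:R ^+ 2)%:E)%E.
Proof.
move=> fg; pose F v := [set w | tail L w /\ G w = g /\ o w = v].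
have FE v : F v = if (v \in vert g) && (L < deg g v)%N then
    [set w | G w = g /\ o w = v] else set0.
  apply/seteqP; split => w /=; case: ifP => //.
  - by move=> _ [_ []].
  - by move=> /negP h [[_ Vo Lo] [eg eo]]; apply: h; rewrite -eg -eo mem_set.
  - by move=> /andP[/set_mem Vv Lv] [eg eo]; rewrite /F /= /tail /= eg eo.
have mF v : measurable (F v).
  by rewrite FE; case: ifP => _ //; case: (ho fg v).
rewrite (_ : tail L `&` _ = \bigcup_v F v); last first.
  by apply/seteqP; split => [w [h1 h2]|w [v _ [h1 [h2 h3]]]] //; exists (o w).
rewrite (@ge0_integral_pieces _ _ _ P F (fun v => (deg g v)%:R ^+ 2)) //; first last.
- by move=> v w [_ [-> ->]].
- by move=> v u _ _ [w [[_ [_ <-]] [_ [_ <-]]]].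
set u := (X in (\sum_(i <oo) X i)%E).
pose N := (\max_(v <- fset_set (vert g)) v).+1.
have u0 v : (0 <= u v)%E by rewrite /u mule_ge0 // lee_fin.
apply: le_trans (@nneseries_lim_ge _ u predT 0 N _) => [|? _ _]; last exact: u0.
have Vn v : v \in fset_set (vert g) -> (v < N)%N.
  by move=> vV; rewrite ltnS; exact: (@leq_bigmax_seq _ _ predT id).
have -> : (\sum_(0 <= v < N) u v = \sum_(v <- fset_set (vert g)) u v)%E.
  rewrite (bigID (fun v => v \in fset_set (vert g))) /= [X in (_ + X)%E]big1 ?adde0.
    rewrite -big_filter; apply: perm_big; apply: uniq_perm;
      [by rewrite filter_uniq // iota_uniq|exact: fset_uniq|].
    move=> v; rewrite mem_filter mem_index_iota /=.
    by case vV : (_ \in _) => //=; rewrite Vn.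
  move=> v; rewrite in_fset_set // => vV.
  by rewrite /u FE (negPf vV) measure0 mule0.
rewrite /large_sq_mean /vmean.
have Pfin : P [set w | G w = g] \is a fin_num.
  by apply: fin_num_measure; exact: hG.1.
rewrite -(fineK Pfin) -EFinM natr_sum mulrCA mulr_sumr mulr_sumr -sumEFin.
rewrite [leLHS]big_seq [leRHS]big_seq; apply: lee_sum => v vV.
rewrite /u FE -in_fset_set // vV /=.
case: ifP => Lv; last by rewrite mul0n mulr0 mulr0 measure0 mule0.
have [_ ->] := ho fg v.
rewrite -in_fset_set // vV -(fineK Pfin) -!EFinM lee_fin mul1n natrX mul1r.
by rewrite /= [leLHS]mulrCA [leRHS]mulrCA [_^-1 * _]mulrC.
Qed.

Lemma markov_large_sq_mean (L : nat) (K e : R) : 0 <= e -> K <= L%:R ^+ 2 ->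
  (e%:E * graph_prob P G [set g | (e < large_sq_mean R g L)%R] <=
   \int[P]_(w in [set w | (K < `|(deg (G w) (o w))%:R ^+ 2 : R|)%R])
     (`|(deg (G w) (o w))%:R ^+ 2 : R|%R)%:E)%E.
Proof.
move=> e0 KL; pose f w : R := (deg (G w) (o w))%:R ^+ 2.
have f0 w : `|f w| = f w by apply/normr_idP; exact: exprn_ge0.
pose U i := [set w | finite_set (vert (G w)) /\ (e < large_sq_mean R (G w) L /\
  choice.pickle (graph_code (G w)) = i)].
have mU i : measurable (U i).
  exact: (measurable_graph_event hG
    [set g | e < large_sq_mean R g L /\ choice.pickle (graph_code g) = i]).
have mtail : measurable (tail L).
  have := measurable_Go [set c | vert c.1 c.2 /\ (L < deg c.1 c.2)%N].
  by congr measurable; apply/seteqP; split => w /= [] // ? [].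
pose F i := tail L `&` U i.
have mF i : measurable (F i) by exact: measurableI.
have tU : trivIset setT U.
  by move=> i j _ _ [w [[_ [_ <-]] [_ [_ <-]]]].
have tF : trivIset setT F by exact: trivIset_setIl.
apply: (@le_trans _ _ (\int[P]_(w in \bigcup_i F i) (f w)%:E)%E); last first.
  under [leRHS]eq_integral do rewrite -/(f _) f0.
  apply: ge0_subset_integral_lower => [w|w [i _ [[_ _ Lw] _]]].
    by rewrite lee_fin exprn_ge0.
  rewrite /= -/(f w) f0; apply: le_lt_trans KL _; rewrite /f.
  by rewrite ltr_pXn2r ?nnegrE // ltr_nat.
rewrite ge0_integral_bigcup //; first last.
- by move=> w _; rewrite lee_fin exprn_ge0.
- apply/measurable_EFinP => mD B mB.
  have := measurable_Go [set c : sgraph * nat | vert c.1 c.2 /\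
    (L < deg c.1 c.2)%N /\ e < large_sq_mean R c.1 L /\ B ((deg c.1 c.2)%:R ^+ 2)].
  congr measurable; apply/seteqP; split => w /=.
    move=> [fw [Vw [Lw [ew Bw]]]]; split => //.
    by exists (choice.pickle (graph_code (G w))).
  by move=> [[i _ [[? ? ?] [? []]]]].
rewrite /graph_prob (_ : graph_event _ _ = \bigcup_i U i); last first.
  apply/seteqP; split => [w [h1 h2]|w [i _ [h1 [h2 _]]]] //.
  by exists (choice.pickle (graph_code (G w))).
rewrite measure_semi_bigcup //; last exact: bigcupT_measurable.
rewrite -nneseriesZl //; apply: lee_nneseries => i *.
  by rewrite mule_ge0 // lee_fin.
have [[w [fw [ew iw]]]|U0] := pselect (U i !=set0); last first.
  have -> : U i = set0 by apply/seteqP; split => // w Uw; apply: U0; exists w.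
  by rewrite measure0 mule0 integral_ge0 // => ? _; rewrite lee_fin exprn_ge0.
have UE : U i = [set w' | G w' = G w].
  apply/seteqP; split => w' /=; last by rewrite /U /= => ->.
  move=> [fw' [ew' iw']]; apply: pickle_graph_code_inj; rewrite ?inE //.
  by rewrite iw iw'.
rewrite /F UE; apply: le_trans (integral_one_graph L fw).
by rewrite muleC; apply: lee_wpmul2l => //; rewrite lee_fin ltW.
Qed.

End markov.

(** * Passage to the limit *)

Lemma ereal_cvg0P (R : realType) (I : Type) (F : set_system I) (FF : Filter F)
    (u : I -> \bar R) : (forall i, 0 <= u i)%E ->
  u @ F --> 0%E <-> forall e : R, 0 < e -> \forall i \near F, (u i <= e%:E)%E.
Proof.
move=> u0; split.
  move=> /fine_cvgP[uf /cvgrPdist_le ucvg] e e0.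
  have := ucvg e e0; apply: filterS2 uf => i fi.
  by rewrite /= sub0r normrN ger0_norm ?fine_ge0 // -lee_fin fineK.
move=> h; apply/fine_cvgP; split.
  have := h 1 ltr01; apply: filterS => i ui.
  by rewrite ge0_fin_numE // (le_lt_trans ui) // ltry.
apply/cvgrPdist_le => e e0; have := h e e0; apply: filterS => i ui.
rewrite /= sub0r normrN ger0_norm ?fine_ge0 // -lee_fin fineK //.
by rewrite ge0_fin_numE // (le_lt_trans ui) // ltry.
Qed.

Section root_properties.
Context (R : realType) (mu : probability rgraph_space R).

Definition root_event (Q : sgraph -> nat -> bool) : set rgraph_space :=
  [set x : clf_rgraph | Q x (groot x)].

Definition ball_types (r : nat) (Q : sgraph -> nat -> bool)
    (s : seq (sgraph * nat)) : Prop :=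
  (forall c, c \in s -> vert c.1 c.2) /\
  forall G v, locally_finite G -> vert G v -> (Q G v : nat) =
    (\sum_(c <- s) `[< rooted_iso (ball_graph G r v) v c.1 c.2 >])%N.

Variables (r : nat) (Q : sgraph -> nat -> bool) (s : seq (sgraph * nat)).
Hypothesis sQ : ball_types r Q s.

Let measurable_ball_event c : c \in s -> measurable (ball_event r c.1 c.2 : set rgraph_space).
Proof.
case: c => H h cs; apply: sub_sigma_algebra; exists r, H, h; split => //.
exact: sQ.1 cs.
Qed.

Let root_event_types : measurable (root_event Q) /\
  mu (root_event Q) = (\sum_(c <- s) mu (ball_event r c.1 c.2))%E.
Proof.
apply: (measure_sum_indicator mu (F := fun c => ball_event r c.1 c.2)) => // x.
rewrite -sQ.2; [|exact: ugraph_locally_finite|exact: groot_vert].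
by rewrite /root_event /=; congr nat_of_bool; apply/asboolP/idP.
Qed.

Lemma measurable_root_event : measurable (root_event Q).
Proof. exact: root_event_types.1. Qed.

Lemma fine_root_event :
  fine (mu (root_event Q)) = \sum_(c <- s) fine (mu (ball_event r c.1 c.2)).
Proof.
rewrite root_event_types.2 [in LHS]big_seq [RHS]big_seq sum_fine // => c cs.
by apply: fin_num_measure; exact: measurable_ball_event.
Qed.

Lemma vmean_types (g : sgraph) :
  vmean R g (Q g) = \sum_(c <- s) ball_freq R g r c.1 c.2.
Proof.
under eq_bigr do rewrite ball_freqE.
rewrite -vmean_sum; apply: eq_vmean => v gv fg; case: sQ => _ -> //.
exact: finite_locally_finite.
Qed.

End root_properties.

Section sequences.
Context {R : realType} {d : nat -> measure_display}.
Context {T : forall n, measurableType (d n)}.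
Variables (P : forall n, probability (T n) R) (G : forall n, T n -> sgraph).
Hypothesis hG : forall n, random_graph (P n) (@G n).

Definition vanishing (Q : set sgraph) : Prop :=
  forall e : R, 0 < e -> \forall n \near \oo, (graph_prob (P n) (@G n) Q <= e%:E)%E.

Lemma vanishing_sub (Q Q' : set sgraph) : Q `<=` Q' -> vanishing Q' -> vanishing Q.
Proof.
move=> QQ' h e /h; apply: filterS => n; apply: le_trans.
by apply: le_graph_prob => // g _; exact: QQ'.
Qed.

Lemma vanishingU (Q Q' : set sgraph) :
  vanishing Q -> vanishing Q' -> vanishing (Q `|` Q').
Proof.
move=> h h' e e0; have e2 : 0 < e / 2 by rewrite divr_gt0.
have := h' _ e2; apply: filterS2 (h _ e2) => n q q'.
rewrite [e]splitr EFinD; apply: le_trans (leeD q q').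
exact: graph_probU.
Qed.

Definition cvg_vanishing (F : sgraph -> R) (c : R) : Prop :=
  forall e : R, 0 < e -> vanishing [set g | e < `|F g - c|].

Lemma cvg_vanishingP (F : sgraph -> R) (c : R) :
    (forall g, infinite_set (vert g) -> F g = 0) ->
  cvg_in_probability P (fun n w => F (G w)) c <-> cvg_vanishing F c.
Proof.
move=> F0; split => h e e0.
  have /ereal_cvg0P := h e e0; move=> /(_ (fun _ => measure_ge0 _ _)) {}h.
  move=> e' e'0; have := h e' e'0; apply: filterS => n.
  by rewrite prob_deviation.
apply/ereal_cvg0P => // e' e'0; have := h e e0 e' e'0; apply: filterS => n.
by rewrite prob_deviation.
Qed.

Lemma cvg_vanishing_sum (I : eqType) (s : seq I) (F : I -> sgraph -> R) (c : I -> R) :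
  (forall i, i \in s -> cvg_vanishing (F i) (c i)) ->
  cvg_vanishing (fun g => \sum_(i <- s) F i g) (\sum_(i <- s) c i).
Proof.
elim: s => [_ e e0|i s IH h e e0].
  move=> e' e'0; near=> n; rewrite /graph_prob (_ : graph_event _ _ = set0).
    by rewrite measure0 lee_fin ltW.
  apply/seteqP; split => w // [_] /=; rewrite !big_nil subr0 normr0.
  by rewrite ltNge ltW.
have e2 : 0 < e / 2 by rewrite divr_gt0.
have hi : cvg_vanishing (F i) (c i) by apply: h; rewrite inE eqxx.
have hs : cvg_vanishing (fun g => \sum_(i <- s) F i g) (\sum_(i <- s) c i).
  by apply: IH => j js; apply: h; rewrite inE js orbT.
apply: vanishing_sub (vanishingU (hi _ e2) (hs _ e2)) => g /=.
rewrite !big_cons opprD addrACA => eF.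
have [|le1] := ltP (e / 2) (`|F i g - c i|); first by left.
right; have := lt_le_trans eF (ler_normD _ _); rewrite {1}[e]splitr => eF2.
by move: eF2 le1; lra.
Unshelve. all: end_near. Qed.

Lemma cvg_vanishingZ (a : R) (F : sgraph -> R) (c : R) :
  0 <= a -> cvg_vanishing F c -> cvg_vanishing (fun g => a * F g) (a * c).
Proof.
move=> a0 h e e0.
have a1 : 0 < a + 1 by rewrite ltr_wpDl.
apply: vanishing_sub (h (e / (a + 1)) _) => [g /=|]; last by rewrite divr_gt0.
rewrite -mulrBr normrM ger0_norm // ltr_pdivrMr // mulrC => ea.
apply: lt_le_trans ea _; rewrite mulrC [leRHS]mulrC ler_wpM2r //; lra.
Qed.

Variable mu : probability rgraph_space R.
Hypothesis hloc : cvg_locally_in_probability P (@G) mu.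

Lemma cvg_vanishing_types (r : nat) (Q : sgraph -> nat -> bool)
    (s : seq (sgraph * nat)) : ball_types r Q s ->
  cvg_vanishing (fun g => vmean R g (Q g)) (fine (mu (root_event Q))).
Proof.
move=> sQ; rewrite (fine_root_event mu sQ).
rewrite (_ : (fun g => _) = fun g => \sum_(c <- s) ball_freq R g r c.1 c.2); last first.
  by apply/funext => g; exact: vmean_types sQ _.
apply: cvg_vanishing_sum => -[H h] cs; apply/cvg_vanishingP; last first.
  exact: (hloc (sQ.1 _ cs)).
by move=> g ig; rewrite ball_freqE vmean_infinite.
Qed.

Variable o : forall n, T n -> nat.
Hypotheses (ho : forall n, uniform_vertex (P n) (@G n) (@o n))
  (hUI : uniformly_integrable P (fun n w => (deg (G w) (o w))%:R ^+ 2)).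

Lemma uniform_large_sq_mean (e e' : R) : 0 < e -> 0 < e' -> exists L : nat,
  forall n, (graph_prob (P n) (@G n) [set g | (e < large_sq_mean R g L)%R] <= e'%:E)%E.
Proof.
move=> e0 e'0; have ee0 : 0 < e * e' by rewrite mulr_gt0.
have sup0 (K : R) : (0 <= ereal_sup (range (tail_expectation P
    (fun n w => (deg (G w) (o w))%:R ^+ 2)%R K)))%E.
  apply: le_trans (ereal_sup_ubound _); last by exists 0%N.
  by apply: integral_ge0 => w _; rewrite lee_fin.
have /(ereal_cvg0P _ sup0) /(_ _ ee0) [K0 [_ hK0]] := hUI.
pose K := Num.max (K0 + 1) 0; exists (Num.bound K) => n.
have /hK0 supK : K0 < K by rewrite lt_max ltrDl ltr01.
have K0' : 0 <= K by rewrite le_max lexx orbT.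
have KL : K <= (Num.bound K)%:R ^+ 2.
  have KB : K <= (Num.bound K)%:R by apply: ltW; exact: archi_boundP.
  apply: (le_trans KB); rewrite -natrX ler_nat expnS expn1.
  by case: (Num.bound K) => // m; rewrite leq_pmulr.
have := markov_large_sq_mean (hG n) (ho n) (ltW e0) KL.
move=> /le_trans /(_ (ereal_sup_ubound _)) /= .
set p := graph_prob _ _ _ => h.
have pfin : p \is a fin_num.
  by apply: fin_num_measure; exact: measurable_graph_event.
have : (e%:E * p <= (e * e')%:E)%E.
  apply: (le_trans (h _ _)) supK; by exists n.
by rewrite -(fineK pfin) -EFinM !lee_fin ler_pM2l.
Qed.

Variable k : nat.

Definition root_deg_sum_event (j : nat) : set rgraph_space :=
  root_event (fun g v => (deg g v == k) && (nbr_deg_sum g v == j)).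

Let p (j : nat) : R := fine (mu (root_deg_sum_event j)).

Let partial (n : nat) : R := \sum_(0 <= j < n) j%:R * p j.

Let p_ge0 j : 0 <= p j.
Proof. by rewrite fine_ge0. Qed.

Lemma cvg_vanishing_deg_sum (m n : nat) :
  cvg_vanishing (fun g => \sum_(m <= j < n) j%:R * deg_sum_freq R g k j)
                (\sum_(m <= j < n) j%:R * p j).
Proof.
apply: (cvg_vanishing_sum (F := fun j g => j%:R * deg_sum_freq R g k j)) => j _.
apply: cvg_vanishingZ => //; have [s sv sE] := deg_sum_types k j.
exact: (@cvg_vanishing_types 2
  (fun g v => (deg g v == k) && (nbr_deg_sum g v == j)) s).
Qed.

(* The bound on the empirical tails passes to the limit. *)
Lemma root_deg_sum_tail (e : R) (L : nat) : 0 < e ->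
    (forall n, (graph_prob (P n) (@G n) [set g | (e < large_sq_mean R g L)%R]
                <= (2^-1)%:E)%E) ->
  forall n, \sum_((k * L).+1 <= j < n) j%:R * p j <= k.+1%:R * e.
Proof.
move=> e0 hL M; rewrite leNgt; apply/negP => lt_tail.
have e4 : 0 < 4^-1 :> R by rewrite invr_gt0.
have [n _ /(_ n (leqnn n)) hn] := cvg_vanishing_deg_sum (k * L).+1 M e0 e4.
have : (graph_prob (P n) (@G n) setT <= (2^-1)%:E + (4^-1)%:E)%E.
  apply: le_trans (leeD (hL n) hn).
  apply: le_trans (graph_probU _ _ _) => //.
  apply: le_graph_prob => // g _ _ /=.
  have [|le_e] := ltP e (large_sq_mean R g L); first by left.
  right; have := le_sum_deg_sum_freq R g k L M.
  set q := \sum_(_ <= _ < _) _ => q_le.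
  have {}q_le : q <= k%:R * e by apply: le_trans q_le _; rewrite ler_wpM2l.
  rewrite distrC; apply: lt_le_trans (ler_norm _).
  by move: lt_tail q_le; rewrite -natr1 mulrDl mul1r; lra.
by rewrite graph_probT // -EFinD lee_fin; lra.
Qed.

Let partial_cat m n : (m <= n)%N ->
  partial n = partial m + \sum_(m <= j < n) j%:R * p j.
Proof. by move=> mn; rewrite /partial (@big_cat_nat _ _ _ m). Qed.

Let partial_nd : {homo partial : m n / (m <= n)%N >-> m <= n}.
Proof.
move=> m n mn; rewrite (partial_cat mn) lerDl; apply: sumr_ge0 => j _.
by rewrite mulr_ge0.
Qed.

Lemma is_cvg_partial : cvgn partial.
Proof.
apply: nondecreasing_is_cvgn => //.
have half : 0 < 2^-1 :> R by rewrite invr_gt0.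
have [L hL] := uniform_large_sq_mean ltr01 half.
exists (partial (k * L).+1 + k.+1%:R) => _ [n _ <-].
have [nm|/ltnW mn] := leqP n (k * L).+1.
  by apply: le_trans (partial_nd nm) _; rewrite lerDl.
rewrite (partial_cat mn) lerD2l; have := root_deg_sum_tail ltr01 hL n.
by rewrite mulr1.
Qed.

Let S : R := limn partial.

Lemma partial_tail (e : R) (L : nat) : 0 < e ->
    (forall n, (graph_prob (P n) (@G n) [set g | (e < large_sq_mean R g L)%R]
                <= (2^-1)%:E)%E) ->
  0 <= S - partial (k * L).+1 <= k.+1%:R * e.
Proof.
move=> e0 hL; apply/andP; split.
  by rewrite subr_ge0; apply: nondecreasing_cvgn_le => //; exact: is_cvg_partial.
rewrite lerBlDr; apply: limr_le; first exact: is_cvg_partial.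
near=> n; have mn : ((k * L).+1 <= n)%N by near: n; exact: nbhs_infty_ge.
by rewrite (partial_cat mn) addrC lerD2r; exact: root_deg_sum_tail.
Unshelve. all: end_near. Qed.

Hypothesis k0 : (0 < k)%N.
Hypothesis muk : (0 < mu (root_deg_eq k))%E.

Let b : R := fine (mu (root_deg_eq k)).

Let root_deg_eqE : root_deg_eq k = root_event (fun g v => deg g v == k).
Proof. by apply/seteqP; split => x /= /eqP. Qed.

Let measurable_root_deg_eq : measurable (root_deg_eq k).
Proof.
have [s sv sE] := deg_types k.
rewrite root_deg_eqE; exact: (measurable_root_event mu (r := 1) (s := s)).
Qed.

Let b_gt0 : 0 < b.
Proof. by rewrite fine_gt0 // muk ltey_eq fin_num_measure. Qed.

Lemma nbr_deg_expectationE : nbr_deg_expectation mu k = (S / (k%:R * b))%:E.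
Proof.
rewrite /nbr_deg_expectation /event_expectation.
have mE j : measurable (root_deg_sum_event j).
  have [s sv sE] := deg_sum_types k j.
  exact: (measurable_root_event mu (r := 2) (s := s)).
have EE : root_deg_eq k = \bigcup_j root_deg_sum_event j.
  apply/seteqP; split => [x /= dx|x [j _ /andP[/eqP]]] //.
  exists (nbr_deg_sum x (groot x)) => //.
  by rewrite /root_deg_sum_event /root_event /= dx !eqxx.
rewrite [in X in (X * _)%E]EE.
rewrite (@ge0_integral_pieces _ _ _ _ _ (fun j => k%:R^-1 * j%:R)) //; first last.
- move=> j x /andP[/eqP dx /eqP <-]; rewrite /nbr_deg_mean dx; congr (_ * _).
  rewrite /nbr_deg_sum natr_sum fsbig_finite //.
  exact/ugraph_locally_finite/groot_vert.
- by move=> i j _ _ [x [/andP[_ /eqP <-] /andP[_ /eqP <-]]].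
set u := (X in (\sum_(i <oo) X i)%E).
have uE i : u i = (k%:R^-1 * (i%:R * p i))%:E.
  have pE : mu (root_deg_sum_event i) = (p i)%:E by rewrite /p fineK // fin_num_measure.
  by rewrite mulrA EFinM; congr (_ * _)%E; exact: pE.
have -> : (\sum_(i <oo) u i = (k%:R^-1 * S)%:E)%E.
  apply/cvg_lim => //; rewrite (_ : (fun n => _) = EFin \o (k%:R^-1 \*o partial)).
    apply: cvg_EFin; first by near=> n.
    by apply: cvgMr; exact: is_cvg_partial.
  apply/funext => n /=; rewrite /partial mulr_sumr -sumEFin.
  by apply: eq_bigr.
by rewrite -EFinM invfM [S * _]mulrA [S * _]mulrC.
Unshelve. all: end_near. Qed.

Lemma annd_cvg :
  cvg_in_probability P (fun n w => annd R (G w) k) (S / (k%:R * b)).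
Proof.
apply/(@cvg_vanishingP (fun g => annd R g k)) => [g ig|].
  by rewrite anndE // vmean_infinite // mul0r.
set c := S / (k%:R * b) => e e0 e' e'0.
have S0 : 0 <= S.
  apply: limr_ge; first exact: is_cvg_partial.
  by near=> n; apply: sumr_ge0 => j _; rewrite mulr_ge0.
have kR : 0 < k%:R :> R by rewrite ltr0n.
have c0 : 0 <= c by rewrite divr_ge0 // mulr_ge0 // ltW.
pose C := 2 * k.+1%:R + c * k%:R.
have C0 : 0 < C by rewrite ltr_pwDl // ?mulr_gt0 // mulr_ge0 // ltW.
pose h := Num.min (b / 2) (e * (b / 2) / C).
have b2 : 0 < b / 2 by rewrite divr_gt0.
have h0 : 0 < h by rewrite lt_min b2 divr_gt0 // mulr_gt0.
have d0 : 0 < Num.min 2^-1 (e' / 2) by rewrite lt_min invr_gt0 ltr0n divr_gt0.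
have [L hL] := uniform_large_sq_mean h0 d0.
have [|tail0 tail1] := andP (partial_tail h0 (L := L) _).
  by move=> n; apply: le_trans (hL n) _; rewrite lee_fin ge_min lexx.
have e2 : 0 < e' / 2 by rewrite divr_gt0.
have [s1 s1v s1E] := deg_types k.
have cvgD : cvg_vanishing (fun g => vmean R g (fun v => deg g v == k)) b.
  by rewrite /b root_deg_eqE; exact: (@cvg_vanishing_types 1 (fun g v => deg g v == k) s1).
have := vanishingU (cvgD _ h0) (cvg_vanishing_deg_sum 0 (k * L).+1 h0).
move=> /(_ _ e2); apply: filterS => n hn.
rewrite [e']splitr EFinD.
have hLn : (graph_prob (P n) (@G n) [set g | (h < large_sq_mean R g L)%R] <= (e' / 2)%:E)%E.
  by apply: le_trans (hL n) _; rewrite lee_fin ge_min lexx orbT.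
apply: le_trans (leeD hn hLn).
apply: le_trans (graph_probU _ _ _) => //.
apply: le_graph_prob => // g _ /=.
have [|large_le] := ltP h (large_sq_mean R g L); first by right.
rewrite anndE //; set D := vmean R g (fun v => deg g v == k).
set A := vmean R g _; set t := \sum_(_ <= j < _) _ * deg_sum_freq _ _ _ _.
have [|D_le] := ltP h `|D - b|; first by left; left.
have [|t_le] := ltP h `|t - partial (k * L).+1|; first by left; right.
rewrite ltNge => /negP[].
have /andP[A0 A1] := truncated_mean_error R g k L.
rewrite -/A -/t in A0 A1.
have {}A1 : A - t <= k%:R * h by apply: le_trans A1 _; rewrite ler_wpM2l.
have D_gt : b / 2 <= D.
  have hb : h <= b / 2 by rewrite ge_min lexx.
  by move: D_le; rewrite ler_norml => /andP[D1 _]; move: D1 hb; lra.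
have kD : b / 2 <= k%:R * D.
  apply: (le_trans D_gt); rewrite ler_peMl ?ler1n //.
  by apply: le_trans D_gt; exact: ltW.
have D0 : 0 < D by exact: lt_le_trans D_gt.
have -> : A / (k%:R * D) - c = ((A - S) - c * k%:R * (D - b)) / (k%:R * D).
  have ck : c * k%:R * b = S by rewrite /c -mulrA divfK // gt_eqF // mulr_gt0.
  rewrite mulrBr ck opprB addrA subrK mulrBl; congr (_ - _).
  by rewrite -(mulrA c) mulfK // gt_eqF // mulr_gt0.
have kD0 : 0 < k%:R * D by exact: mulr_gt0.
rewrite normrM normfV (gtr0_norm kD0) ler_pdivrMr //.
apply: (@le_trans _ _ (e * (b / 2))); last by rewrite ler_pM2l.
apply: (@le_trans _ _ (C * h)); last first.
  rewrite mulrC -ler_pdivlMr // ge_min lexx orbT //.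
rewrite /C mulrDl; apply: le_trans (ler_normB _ _) _; apply: lerD; last first.
  by rewrite normrM ger0_norm ?ler_wpM2l // mulr_ge0 // ltW.
move: t_le tail0 tail1 A0 A1; rewrite ler_norml -natr1 => /andP[t1 t2] s1' s2 a1 a2.
by rewrite ler_norml; apply/andP; split; lra.
Unshelve. all: end_near. Qed.

End sequences.

Theorem theorem2p6 (R : realType) (d : nat -> measure_display)
  (T : forall n, measurableType (d n)) (P : forall n, probability (T n) R)
  (G : forall n, T n -> sgraph) (o : forall n, T n -> nat)
  (mu : probability rgraph_space R)
  (hG : forall n, random_graph (P n) (G n))
  (ho : forall n, uniform_vertex (P n) (G n) (o n))
  (hUI : uniformly_integrable P (fun n w => (deg (G n w) (o n w))%:R ^+ 2))
  (hmu : (0 < mu [set x : clf_rgraph | (1 <= deg x (groot x))%N])%E)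
  (hloc : cvg_locally_in_probability P G mu)
  (k : nat) (hk : (1 <= k)%N) (hmuk : (0 < mu (root_deg_eq k))%E) :
  nbr_deg_expectation mu k \is a fin_num /\
  cvg_in_probability P (fun n w => annd R (G n w) k)
                       (fine (nbr_deg_expectation mu k)).
Proof.
have -> := nbr_deg_expectationE hG hloc ho hUI k.
split; [by []|exact: (annd_cvg hG hloc ho hUI hk hmuk)].
Qed.
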